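(* There exists a function $f\in l^1(\mathbb{Z})$ such that $$\sup_{n\in\mathbb{Z}}|\mathcal{F}f(n+1)-\mathcal{F}f(n)|=\infty,$$ where $\mathcal{F}f$ is the discrete frequency function of $f$.
   Context: $\mathbb{Z}^+$ denotes the set of non-negative integers (including $0$). $l^1(\mathbb{Z})$ is the space of absolutely summable (real- or complex-valued) functions on $\mathbb{Z}$. For $f\in l^1(\mathbb{Z})$, $n\in\mathbb{Z}$ and $r\in\mathbb{Z}^+$ put $$\mathcal{A}_rf(n):=\frac{1}{2r+1}\sum_{k=-r}^{r}|f(n+k)|,\qquad \mathcal{M}f(n):=\sup_{r\in\mathbb{Z}^+}\mathcal{A}_rf(n),$$ $$E_{f,n}:=\{r\in\mathbb{Z}^+:\ \mathcal{M}f(n)=\mathcal{A}_rf(n)\}.$$ The set $E_{f,n}$ is always non-empty, and the discrete frequency function is $\mathcal{F}f(n):=\inf E_{f,n}$, i.e. the smallest $r\in\mathbb{Z}^+$ for which the supremum defining $\mathcal{M}f(n)$ is attained. *)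

(* Defs.v *)
From mathcomp Require Import all_boot all_order all_algebra.
From mathcomp Require Import all_classical all_reals all_analysis.

Set Implicit Arguments.
Unset Strict Implicit.
Unset Printing Implicit Defensive.

Import Order.TTheory GRing.Theory Num.Theory.

Local Open Scope classical_set_scope.
Local Open Scope ring_scope.

(* The index i < 2r+1 stands for k = i - r, which runs over -r, ..., r. *)
Definition discrete_average (R : realType) (f : int -> R) (r : nat) (n : int)
    : R :=
  (2 * r + 1)%:R^-1 * \sum_(i < (2 * r + 1)%N) `|f (n + (i%:Z - r%:Z))|.

(* The supremum is taken in the extended reals; it is finite when f is
   summable. *)
Definition discrete_maximal (R : realType) (f : int -> R) (n : int) : \bar R :=
  ereal_sup [set (discrete_average f r n)%:E | r in [set: nat]].

Definition maximal_radii (R : realType) (f : int -> R) (n : int) : set nat :=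
  [set r | discrete_maximal f n = (discrete_average f r n)%:E].

(* For summable f the set maximal_radii f n is nonempty, so this infimum of
   natural numbers, computed in R, is its least element.  (On the empty set
   inf returns 0, which can only happen when f is not summable.) *)
Definition discrete_frequency (R : realType) (f : int -> R) (n : int) : R :=
  inf [set r%:R | r in maximal_radii f n].

(* Main.v *)
(* Two unit masses at distance 3k, seen from the point at distance j from the
   left one: the average is largest at radius j (left mass only) while j < k,
   and at radius 3k - j (both masses) once j >= k, so the frequency jumps from
   k - 1 to 2k between j = k - 1 and j = k.  The function f is the sum of such
   pairs with weights 2^-k, placed so far apart that a radius reaching another
   pair only gives averages too small to compete, since the total mass of f is
   at most 4. *)

Require Import Defs.
From mathcomp Require Import all_boot all_order all_algebra.
From mathcomp Require Import all_classical all_reals all_analysis.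
From mathcomp Require Import zify ring lra.

Import Order.TTheory GRing.Theory Num.Theory.

Local Open Scope classical_set_scope.
Local Open Scope ring_scope.

(** The supremum is attained at [r0], and strictness below [r0] makes [r0] the least radius
    attaining it. *)
Lemma discrete_frequency_eq (R : realType) (f : int -> R) (n : int) (r0 : nat) :
  (forall r, discrete_average f r n <= discrete_average f r0 n) ->
  (forall r, (r < r0)%N -> discrete_average f r n < discrete_average f r0 n) ->
  discrete_frequency f n = r0%:R.
Proof.
move=> maxr0 minr0.
have supE : discrete_maximal f n = (discrete_average f r0 n)%:E.
  apply/eqP; rewrite eq_le; apply/andP; split.
    by apply: ge_ereal_sup => _ [r _ <-]; rewrite lee_fin.
  by apply: ereal_sup_ubound; exists r0.
have r0E : maximal_radii f n r0 by [].
have lb : lbound [set (r%:R : R) | r in maximal_radii f n] r0%:R.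
  move=> _ [r + <-]; rewrite /maximal_radii /= supE => -[rE].
  by rewrite ler_nat leqNgt; apply/negP => /minr0; rewrite rE ltxx.
apply/eqP; rewrite eq_le; apply/andP; split.
  by apply: ge_inf; [exists r0%:R | exists r0].
by apply: lb_le_inf => //; exists r0%:R, r0.
Qed.

(** * Point counts and a geometric sum *)

Lemma sum_window_point (R : realType) (n p : int) (r : nat) :
  \sum_(i < (2 * r + 1)%N) (n + (i%:Z - r%:Z) == p)%:R
  = (`|n - p| <= r)%N%:R :> R.
Proof.
case: (leqP `|n - p|%N r) => npr; last first.
  by rewrite big1 // => i _; case: eqP => // ?; have := ltn_ord i; lia.
(* The only index whose point is [p]. *)
have lti : (absz (p - n + r%:Z)%R < 2 * r + 1)%N by lia.
rewrite (bigD1 (Ordinal lti)) //= big1 => [|i /eqP ne].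
  by rewrite addr0; case: eqP => //; lia.
by case: eqP => // ?; case: ne; apply: val_inj => /=; lia.
Qed.

Lemma sum_uniq_point (R : realType) (s : seq int) (p : int) :
  uniq s -> \sum_(z <- s) (z == p)%:R = (p \in s)%:R :> R.
Proof.
move=> us; rewrite -(count_uniq_mem _ us) -sum1_count natr_sum [RHS]big_mkcond.
by apply: eq_bigr => z _ /=; case: eqP.
Qed.

Lemma sum_geometric_half (R : realType) (N : nat) :
  \sum_(k < N) 2^-1 ^+ k <= 2 :> R.
Proof.
suff -> : \sum_(k < N) 2^-1 ^+ k = 2 - 2 * 2^-1 ^+ N :> R.
  have : 0 <= (2^-1 : R) ^+ N by rewrite exprn_ge0.
  lra.
elim: N => [|N IH]; first by rewrite big_ord0 expr0; ring.
by rewrite big_ord_recr /= IH exprS; field.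
Qed.

(** * Positions of the spikes *)

Definition left_spike (k : nat) : nat := (16 ^ k.+1)%N.
Definition right_spike (k : nat) : nat := (left_spike k + 3 * k)%N.

(** The three terms on the left are at most 1, 3 and 8 times [16 ^ k], and 12 < 16. The gap
    [8 * 4 ^ k] is the radius up to which pair [k] is to be seen alone. *)
Lemma spikes_separated (j k : nat) :
  (j < k)%N -> (right_spike j + 8 * 4 ^ k < left_spike k)%N.
Proof.
move=> jk; rewrite /right_spike /left_spike (expnS 16 k).
have h1 : (16 ^ j.+1 <= 16 ^ k)%N by rewrite leq_exp2l.
have h2 : (k < 16 ^ k)%N by exact: ltn_expl.
have h3 : (4 ^ k <= 16 ^ k)%N by rewrite leq_exp2r //; lia.
lia.
Qed.

Lemma gt_left_spike (k : nat) : (k < left_spike k)%N.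
Proof. by rewrite /left_spike; have := @ltn_expl 16 k.+1 isT; lia. Qed.

(** * The function, its summability and its averages *)

Section Spikes.
Variable R : realType.

(* The spikes of index k lie to the right of k, so truncating the series at
   |z| loses nothing. *)
Definition spikes (z : int) : R :=
  \sum_(k < `|z|.+1)
    2^-1 ^+ k * ((z == left_spike k)%:R + (z == right_spike k)%:R).

Lemma spikes_widen (N : nat) (z : int) : (`|z| < N)%N ->
  spikes z = \sum_(k < N)
    2^-1 ^+ k * ((z == left_spike k)%:R + (z == right_spike k)%:R).
Proof.
move=> zN; rewrite /spikes (big_ord_widen N
  (fun k => 2^-1 ^+ k * ((z == left_spike k)%:R + (z == right_spike k)%:R))) //.
rewrite big_mkcond; apply: eq_bigr => k _; case: ltnP => // zk.
have := gt_left_spike k => kl.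
have -> : (z == left_spike k) = false by lia.
have -> : (z == right_spike k) = false by rewrite /right_spike; lia.
by rewrite addr0 mulr0.
Qed.

Lemma spikes_ge0 (z : int) : 0 <= spikes z.
Proof. by apply: sumr_ge0 => k _; rewrite mulr_ge0 ?exprn_ge0 ?addr_ge0. Qed.

(** Bounds the total mass, over a finite set as well as over a window: each bracket is at most 2,
    and so is the geometric sum. *)
Lemma weighted_bool_sum_le4 (N : nat) (a b : nat -> bool) :
  \sum_(k < N) 2^-1 ^+ k * ((a k)%:R + (b k)%:R) <= 4 :> R.
Proof.
apply: (@le_trans _ _ (2 * \sum_(k < N) 2^-1 ^+ k)); last first.
  have := sum_geometric_half R N; lra.
rewrite mulr_sumr; apply: ler_sum => k _; rewrite mulrC ler_wpM2r ?exprn_ge0 //.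
by case: (a k); case: (b k) => /=; lra.
Qed.

Lemma sum_uniq_spikes_le4 (s : seq int) : uniq s -> \sum_(z <- s) spikes z <= 4.
Proof.
(* One truncation serves all points of [s], so the two sums can be exchanged. *)
move=> us; pose N := (\max_(z <- s) `|z|%N).+1.
suff -> : \sum_(z <- s) spikes z = \sum_(k < N) 2^-1 ^+ k *
    (((left_spike k)%:Z \in s)%:R + ((right_spike k)%:Z \in s)%:R).
  exact: (weighted_bool_sum_le4 N
    (fun k => (left_spike k)%:Z \in s) (fun k => (right_spike k)%:Z \in s)).
rewrite (eq_big_seq (fun z : int => \sum_(k < N) 2^-1 ^+ k *
  ((z == left_spike k)%:R + (z == right_spike k)%:R))); last first.
  move=> z zs; apply: spikes_widen; rewrite /N ltnS.
  exact: (@leq_bigmax_seq _ s xpredT absz z zs isT).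
rewrite exchange_big; apply: eq_bigr => k _ /=.
by rewrite -mulr_sumr big_split /= !sum_uniq_point.
Qed.

Lemma summable_spikes : summable [set: int] (fun n => (spikes n)%:E).
Proof.
rewrite /summable; apply: (@le_lt_trans _ _ 4%:E); last exact: ltry.
apply: ge_ereal_sup => _ [A [finA _] <-].
rewrite fsbig_finite //= (eq_bigr (fun z => (spikes z)%:E)); last first.
  by move=> z _; rewrite /= ger0_norm // spikes_ge0.
by rewrite sumEFin lee_fin sum_uniq_spikes_le4 // finmap.fset_uniq.
Qed.

(** The window stays within [|z| < N], so the sums exchange and each spike is counted once if within
    [r] of [n]. Leaving [N] free lets a chosen index be included. *)
Lemma discrete_average_spikes (r : nat) (n : int) (N : nat) :
  (`|n| + r < N)%N ->
  discrete_average spikes r n = (2 * r + 1)%:R^-1 *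
    \sum_(k < N) 2^-1 ^+ k * ((`|n - left_spike k| <= r)%N%:R
                            + (`|n - right_spike k| <= r)%N%:R).
Proof.
move=> nrN; rewrite /discrete_average; congr (_ * _).
under eq_bigr => i _.
  rewrite ger0_norm ?spikes_ge0 // (@spikes_widen N); last first.
    by have := ltn_ord i; lia.
  over.
rewrite exchange_big; apply: eq_bigr => k _ /=.
by rewrite -mulr_sumr big_split /= !sum_window_point.
Qed.

Lemma discrete_average_spikes_le (r : nat) (n : int) :
  discrete_average spikes r n <= 4 / (2 * r + 1)%:R.
Proof.
rewrite (@discrete_average_spikes r n (`|n| + r).+1) // mulrC.
rewrite ler_wpM2r ?invr_ge0 //.
exact: (weighted_bool_sum_le4 _ (fun k => `|n - left_spike k| <= r)%N
  (fun k => `|n - right_spike k| <= r)%N).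
Qed.

(** From a point between the spikes of pair [k], such radii reach no other pair. *)
Lemma discrete_average_spikes_near (k m r : nat) :
  (left_spike k <= m <= right_spike k)%N -> (r <= 8 * 4 ^ k)%N ->
  discrete_average spikes r m = 2^-1 ^+ k / (2 * r + 1)%:R *
    ((m - left_spike k <= r)%N%:R + (right_spike k - m <= r)%N%:R).
Proof.
move=> /andP[lm mr] rk.
have kN : (k < (m + r + k).+1)%N by lia.
rewrite (@discrete_average_spikes r m (m + r + k).+1); last by lia.
rewrite (bigD1 (Ordinal kN)) //= big1 => [|j /eqP ne].
  rewrite addr0 mulrA (mulrC _^-1); congr (_ * (_%:R + _%:R)).
    by congr (nat_of_bool _); lia.
  by congr (nat_of_bool _); lia.
have {}ne : (j : nat) <> k by move=> jk; apply: ne; exact: val_inj.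
have lr i : (left_spike i <= right_spike i)%N by rewrite /right_spike; lia.
have [far1 far2] : (r < `|m%:Z - left_spike j|)%N /\
                   (r < `|m%:Z - right_spike j|)%N.
  (* Pairs to the left end before the gap [8 * 4 ^ k]; pairs to the right start after the even
     larger gap [8 * 4 ^ j]. *)
  have := lr j; have [jk|kj|//] := ltngtP j k.
    by have := spikes_separated _ _ jk; lia.
  have := spikes_separated _ _ kj.
  have : (4 ^ k <= 4 ^ j)%N by rewrite leq_exp2l // ltnW.
  by lia.
by rewrite leqNgt far1 leqNgt far2 addr0 mulr0.
Qed.

(* Beyond 8 * 4 ^ k the bound 4 / (2 r + 1) by the total mass takes over. *)
Lemma discrete_average_spikes_far (k r : nat) (n : int) :
  (8 * 4 ^ k < r)%N ->
  discrete_average spikes r n <= 2^-1 ^+ k / (2 * k + 1)%:R.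
Proof.
move=> kr; apply: (le_trans (discrete_average_spikes_le r n)).
have k2 : (k < 2 ^ k)%N by exact: ltn_expl.
rewrite exprVn -invfM ler_pdivrMr ?ltr0n ?addn1 //.
rewrite mulrC ler_pdivlMr ?mulr_gt0 ?exprn_gt0 ?ltr0n //.
rewrite -natrX -!natrM ler_nat.
(* As [2 * k + 1 <= 2 * 2 ^ k], the product [4 * 2 ^ k * (2 * k + 1)] is at most [8 * 4 ^ k]; hence
   the threshold. *)
move: kr; rewrite (_ : 4 = 2 * 2)%N // expnMn; nia.
Qed.

(** * Frequencies on the two sides of the jump *)

Lemma discrete_frequency_spikes_far (k : nat) :
  discrete_frequency spikes (left_spike k + k)%N = (2 * k)%:R.
Proof.
have k2 : (k <= 4 ^ k)%N by rewrite ltnW // ltn_expl.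
have w_gt0 : 0 < (2^-1 : R) ^+ k by rewrite exprn_gt0.
have range : (left_spike k <= left_spike k + k <= right_spike k)%N.
  by rewrite /right_spike; lia.
have k_ge0 : 0 <= k%:R :> R by [].
have maxE : discrete_average spikes (2 * k) (left_spike k + k)%N
    = 2^-1 ^+ k * (2 / (4 * k%:R + 1)).
  rewrite (@discrete_average_spikes_near k) //; last by lia.
  rewrite (_ : (_ <= _)%N = true); last by lia.
  rewrite (_ : (_ <= _)%N = true); last by rewrite /right_spike; lia.
  rewrite natrD !natrM /=; field.
  by apply: lt0r_neq0; lra.
have low r : (r < 2 * k)%N ->
    discrete_average spikes r (left_spike k + k)%N
    < discrete_average spikes (2 * k) (left_spike k + k)%N.
  move=> rk; rewrite maxE (@discrete_average_spikes_near k) //; last by lia.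
  rewrite [X in _ + X%:R](_ : _ = 0%N); last by rewrite /right_spike; lia.
  rewrite addr0 -mulrA ltr_pM2l // natrD natrM.
  case: (leqP _ r) => /= kr; last first.
    by rewrite mulr0 divr_gt0 //; lra.
  have {}kr : k%:R <= r%:R :> R by rewrite ler_nat; lia.
  (* One spike at radius at least [k] loses, barely: [1 / (2k + 1) < 2 / (4k + 1)]. *)
  rewrite mulr1 invf_plt ?posrE; first by rewrite invf_div; lra.
    by lra.
  by rewrite divr_gt0 //; lra.
apply: discrete_frequency_eq => // r.
case: (ltnP r (2 * k)) => rk; first exact/ltW/low.
rewrite maxE; case: (leqP r (8 * 4 ^ k)) => r8; last first.
  apply: (le_trans (discrete_average_spikes_far _ _ _ r8)).
  rewrite ler_pM2l // natrD natrM -[leLHS]mul1r.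
  rewrite ler_pdivrMr; last by lra.
  by rewrite mulrAC ler_pdivlMr; lra.
rewrite (@discrete_average_spikes_near k) // -mulrA ler_pM2l //.
have {}rk : 2 * k%:R <= r%:R :> R by rewrite -natrM ler_nat.
have r_gt0 : 0 < 2 * r%:R + 1 :> R by lra.
rewrite natrD natrM mulrC ler_pdivrMr //.
rewrite mulrAC ler_pdivlMr; last by lra.
by case: (_ <= _)%N; case: (_ <= _)%N => /=; lra.
Qed.

(** In pair [k.+1] the right spike is at distance [2k + 3], where two spikes give at most
    [2 / (4k + 7)], less than the [1 / (2k + 1)] of the left one at radius [k]. *)
Lemma discrete_frequency_spikes_near (k : nat) :
  discrete_frequency spikes (left_spike k.+1 + k)%N = k%:R.
Proof.
have k2 : (k.+1 <= 4 ^ k.+1)%N by rewrite ltnW // ltn_expl.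
have w_gt0 : 0 < (2^-1 : R) ^+ k.+1 by rewrite exprn_gt0.
have range : (left_spike k.+1 <= left_spike k.+1 + k <= right_spike k.+1)%N.
  by rewrite /right_spike; lia.
have k_ge0 : 0 <= k%:R :> R by [].
have maxE : discrete_average spikes k (left_spike k.+1 + k)%N
    = 2^-1 ^+ k.+1 * (1 / (2 * k%:R + 1)).
  rewrite (@discrete_average_spikes_near k.+1) //; last by lia.
  rewrite (_ : (_ <= _)%N = true); last by lia.
  rewrite (_ : (_ <= _)%N = false); last by rewrite /right_spike; lia.
  by rewrite natrD natrM addr0 mulr1 mul1r.
have max_gt0 : 0 < discrete_average spikes k (left_spike k.+1 + k)%N.
  by rewrite maxE mulr_gt0 // divr_gt0 //; lra.
have low r : (r < k)%N ->
    discrete_average spikes r (left_spike k.+1 + k)%N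
    < discrete_average spikes k (left_spike k.+1 + k)%N.
  move=> rk; rewrite (@discrete_average_spikes_near k.+1) //; last by lia.
  (* Below radius [k] neither spike is reached, so the average vanishes. *)
  rewrite [X in X%:R + _](_ : _ = 0%N); last by lia.
  rewrite [X in _ + X%:R](_ : _ = 0%N); last by rewrite /right_spike; lia.
  by rewrite addr0 mulr0.
apply: discrete_frequency_eq => // r.
case: (ltnP r k) => rk; first exact/ltW/low.
rewrite maxE; case: (leqP r (8 * 4 ^ k.+1)) => r8; last first.
  apply: (le_trans (discrete_average_spikes_far _ _ _ r8)).
  rewrite ler_pM2l // natrD natrM mul1r lef_pV2 ?posrE -?natr1; lra.
rewrite (@discrete_average_spikes_near k.+1) // -mulrA ler_pM2l //.
have {}rk : k%:R <= r%:R :> R by rewrite ler_nat.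
have r_gt0 : 0 < 2 * r%:R + 1 :> R by lra.
rewrite natrD natrM mulrC ler_pdivrMr //.
rewrite mulrAC ler_pdivlMr; last by lra.
have [kr|_] := leqP (right_spike k.+1 - _)%N r; last first.
  by case: (_ <= _)%N => /=; lra.
have {}kr : 2 * k%:R + 3 <= r%:R :> R.
  rewrite -natrM -natrD ler_nat; move: kr; rewrite /right_spike; lia.
by case: (_ <= _)%N => /=; lra.
Qed.

End Spikes.

Theorem mainTheorem5 (R : realType) :
  exists f : int -> R,
    summable [set: int] (fun n => (f n)%:E) /\
    ereal_sup [set `|discrete_frequency f (n + 1) - discrete_frequency f n|%:E
              | n in [set: int]] = +oo%E.
Proof.
exists (spikes R); split; first exact: summable_spikes.
apply/eqyP => A A_gt0.
(* The frequency jumps from [k] to [2 * k.+1], that is by [k + 2], which exceeds [A]. *)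
pose k := Num.bound A.
pose n : int := (left_spike k.+1 + k)%N.
apply: (@le_trans _ _ `|discrete_frequency (spikes R) (n + 1)
                       - discrete_frequency (spikes R) n|%:E); last first.
  by apply: ereal_sup_ubound; exists n.
rewrite (_ : n + 1 = (left_spike k.+1 + k.+1)%N); last by lia.
rewrite discrete_frequency_spikes_far discrete_frequency_spikes_near.
rewrite lee_fin; apply: le_trans (ler_norm _).
have := archi_boundP (ltW A_gt0); rewrite -/k natrM -natr1.
have : 0 <= k%:R :> R by [].
lra.
Qed.
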